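(* Let $N\subset\mathbb{R}^4$ be a regular surface with $p=0\in N$, given near $p$ in Monge form $X(x,y)=(x,y,f_1(x,y),f_2(x,y))$, where $f_1,f_2$ are smooth with no constant or linear part at the origin. Let ${\bf v}=(0,1)\in T_pN$, that is, ${\bf v}=(0,1,0,0)$, and let $\pi_{\bf v}(N)\subset\mathbb{R}^3$ be the projection of $N$ along ${\bf v}$, parametrised by $f(x,y)=(x,f_1(x,y),f_2(x,y))$. (i) The number of asymptotic directions of $N$ at $p$ and the number of asymptotic directions of $\pi_{\bf v}(N)$ at $\pi_{\bf v}(p)$ are equal. (ii) The numbers of binormal directions of $N$ at $p$ and of $\pi_{\bf v}(N)$ at $\pi_{\bf v}(p)$ are equal. Moreover, if $\nu\in N_pN$ is a binormal direction of $N$ at $p$, then it is also a binormal direction of $\pi_{\bf v}(N)$ at $\pi_{\bf v}(p)$.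
   Context: Orthogonal projection along a unit vector ${\bf v}$: $\pi_{\bf v}(z)=z-\langle z,{\bf v}\rangle{\bf v}$, with image ${\bf v}^\perp\cong\mathbb{R}^3$. All directions (asymptotic and binormal) are counted up to nonzero scalar multiples, and the number may be infinite. Regular surfaces in $\mathbb{R}^4$. For $p\in N$ with orthonormal bases $\{e_1,e_2\}$ of $T_pN$ and $\{e_3,e_4\}$ of $N_pN$, the second fundamental form is $II_p(w_1e_1+w_2e_2)=\sum_{i=1}^2(l_iw_1^2+2m_iw_1w_2+n_iw_2^2)e_{i+2}$, where, in a parametrisation with $X_x=e_1$, $X_y=e_2$ at $p$, $l_i=\langle X_{xx},e_{i+2}\rangle$, $m_i=\langle X_{xy},e_{i+2}\rangle$, $n_i=\langle X_{yy},e_{i+2}\rangle$ at $p$. Put $\eta(\theta)=II_p(\cos\theta\,e_1+\sin\theta\,e_2)$. A tangent direction $\theta$ is asymptotic at $p$ if $\eta(\theta)$ and $\frac{d\eta}{d\theta}(\theta)$ are linearly dependent. A nonzero normal vector $\nu\in N_pN$ gives a binormal direction of $N$ at $p=X(u)$ if the height function $h_\nu=\langle X,\nu\rangle$ has a degenerate (non-Morse) singularity at $u$. Corank $1$ surfaces in $\mathbb{R}^3$. Let $M$ be the image of a smooth map $g:\tilde M\to\mathbb{R}^3$ from a regular surface, of corank $1$ at $q$, with $g(q)=m$. Let $T_mM=\mathrm{im}(dg_q)$ and let $N_mM$ be its orthogonal complement (a plane) with orthogonal projection $\perp$ onto it. The second fundamental form $II:T_q\tilde M\times T_q\tilde M\to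 N_mM$ is the symmetric bilinear map given in local coordinates $(x,y)$ of $\tilde M$, with corresponding local parametrisation $f$ of $M$, by $II(\partial_x,\partial_x)=f_{xx}^\perp$, $II(\partial_x,\partial_y)=f_{xy}^\perp$, $II(\partial_y,\partial_y)=f_{yy}^\perp$ at $q$, and $II_\nu=\langle II,\nu\rangle$ for $\nu\in N_mM$. A nonzero $Y\in T_q\tilde M$ is an asymptotic direction if there is a nonzero $\nu\in N_mM$ with $II_\nu(Y,Z)=0$ for all $Z\in T_q\tilde M$; in that case $\nu$ is called a binormal direction. For $M=\pi_{\bf v}(N)$, the map $g$ is $f(x,y)=(x,f_1(x,y),f_2(x,y))$ with $q=0$, and the normal plane $N_{\pi_{\bf v}(p)}\pi_{\bf v}(N)$ is identified with $N_pN$ (both are the plane of the last two coordinates). *)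

(* Defs.v *)
From HB Require Import structures.
From mathcomp Require Import all_boot all_order all_algebra.
From mathcomp Require Import all_classical all_reals all_analysis.

Set Implicit Arguments.
Unset Strict Implicit.
Unset Printing Implicit Defensive.

Import Order.TTheory GRing.Theory Num.Theory.
Import numFieldNormedType.Exports.

Local Open Scope classical_set_scope.
Local Open Scope ring_scope.

Definition dot (R : realType) (n : nat) (a b : 'rV[R]_n) : R :=
  \sum_(i < n) a 0 i * b 0 i.

(* C^infty on U (meant for U open): every iterated directional derivative is
   (Frechet) differentiable at every point of U. *)
Definition smooth_on (R : realType) (V W : normedModType R) (U : set V)
    (f : V -> W) : Prop :=
  forall (s : seq V) (x : V), U x ->
    differentiable (foldr (fun w g => 'D_w g) f s) x.

(* [partial 0 f] is f_x and [partial 1 f] is f_y. *)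
Definition partial (R : realType) (W : normedModType R) (i : 'I_2)
    (f : 'rV[R]_2 -> W) : 'rV[R]_2 -> W :=
  'D_(delta_mx 0 i : 'rV[R]_2) f.

(* The set of lines spanned by the vectors of A: directions are counted up to
   nonzero scalar multiples.  All sets A below consist of nonzero vectors. *)
Definition directions (R : realType) (n : nat) (A : set 'rV[R]_n) :
    set {vspace 'rV[R]_n} :=
  [set <[w]>%VS | w in A].

Section Surfaces4.
Variable R : realType.
Implicit Types (N : set 'rV[R]_4) (p : 'rV[R]_4) (X : 'rV[R]_2 -> 'rV[R]_4).
Implicit Types (U : set 'rV[R]_2) (u : 'rV[R]_2) (e : 'I_(2 + 2) -> 'rV[R]_4).

(* X : U -> N is a local parametrisation of N near p = X u: a smooth immersion
   of the open set U which is a homeomorphism onto a relatively open subset of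
   N.  X is a total function; its values outside U are irrelevant. *)
Record local_parametrisation N p X U u : Prop := LocalParametrisation {
  lp_open : open U;
  lp_mem : U u;
  lp_base : X u = p;
  lp_smooth : smooth_on U X;
  lp_immersion : forall z, U z -> injective ('d X z);
  lp_homeo : exists (W : set 'rV[R]_4) (Y : 'rV[R]_4 -> 'rV[R]_2),
    [/\ open W, X @` U = N `&` W, forall z, U z -> Y (X z) = z &
        {within N `&` W, continuous Y}] }.

Definition regular_surface N : Prop :=
  forall p, N p -> exists X U u, local_parametrisation N p X U u.

(* e lists orthonormal bases {e_1, e_2} (indices lshift 2 i) of the tangent
   plane and {e_3, e_4} (indices rshift 2 i) of the normal plane at X u, with
   X_x = e_1 and X_y = e_2 at u. *)
Definition adapted_frame X u e : Prop :=
  (forall i j, dot (e i) (e j) = (i == j)%:R) /\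
  (forall i : 'I_2, partial i X u = e (lshift 2 i)).

Definition second_ff X u e (w1 w2 : R) : 'rV[R]_4 :=
  \sum_(i < 2)
    (let l := dot (partial 0 (partial 0 X) u) (e (rshift 2 i)) in
     let m := dot (partial 1 (partial 0 X) u) (e (rshift 2 i)) in
     let n := dot (partial 1 (partial 1 X) u) (e (rshift 2 i)) in
     l * w1 ^+ 2 + 2 * m * w1 * w2 + n * w2 ^+ 2) *: e (rshift 2 i).

Definition curvature_ellipse X u e (theta : R) : 'rV[R]_4 :=
  second_ff X u e (cos theta) (sin theta).

(* The unit tangent vectors of N at p whose direction is asymptotic. *)
Definition asymptotic N p : set 'rV[R]_4 :=
  [set w | exists X U u e (theta : R),
    [/\ local_parametrisation N p X U u,
        adapted_frame X u e,
        w = cos theta *: e (lshift 2 0) + sin theta *: e (lshift 2 1) &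
        ~~ free [:: curvature_ellipse X u e theta;
                    derive1 (curvature_ellipse X u e) theta]]].

Definition hessian (h : 'rV[R]_2 -> R) u : 'M[R]_2 :=
  \matrix_(i, j) partial i (partial j h) u.

Definition degenerate_singularity (h : 'rV[R]_2 -> R) u : Prop :=
  (forall i, partial i h u = 0) /\ \det (hessian h u) = 0.

Definition height X (nu : 'rV[R]_4) : 'rV[R]_2 -> R := fun z => dot (X z) nu.

Definition binormal N p : set 'rV[R]_4 :=
  [set nu | nu != 0 /\ exists X U u,
    [/\ local_parametrisation N p X U u,
        forall w, dot ('d X u w) nu = 0 &
        degenerate_singularity (height X nu) u]].

Definition monge (f1 f2 : 'rV[R]_2 -> R) : 'rV[R]_2 -> 'rV[R]_4 :=
  fun z => \row_i [:: z 0 0; z 0 1; f1 z; f2 z]`_i.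

End Surfaces4.

(* Corank 1 surfaces in R^3, described near m = g q by the map g written in
   local coordinates of the source surface; tangent vectors of the source at q
   are coordinate vectors in R^2. *)
Section Surfaces3.
Variable R : realType.
Implicit Types (g : 'rV[R]_2 -> 'rV[R]_3) (q : 'rV[R]_2).

Definition tangent_image g q : set 'rV[R]_3 := range ('d g q).

Definition normal_space g q : set 'rV[R]_3 :=
  [set nu | forall t, tangent_image g q t -> dot t nu = 0].

(* The orthogonal projection of z onto the linear subspace S. *)
Definition orth_proj (S : set 'rV[R]_3) (z : 'rV[R]_3) : 'rV[R]_3 :=
  xget 0 [set a | S a /\ forall b, S b -> dot (z - a) b = 0].

Definition second_ff3 g q (Y Z : 'rV[R]_2) : 'rV[R]_3 :=
  let perp := orth_proj (normal_space g q) in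
  (Y 0 0 * Z 0 0) *: perp (partial 0 (partial 0 g) q)
  + (Y 0 0 * Z 0 1 + Y 0 1 * Z 0 0) *: perp (partial 1 (partial 0 g) q)
  + (Y 0 1 * Z 0 1) *: perp (partial 1 (partial 1 g) q).

Definition asymptotic_binormal3 g q (Y : 'rV[R]_2) (nu : 'rV[R]_3) : Prop :=
  [/\ Y != 0, nu != 0, normal_space g q nu &
      forall Z, dot (second_ff3 g q Y Z) nu = 0].

Definition asymptotic3 g q : set 'rV[R]_2 :=
  [set Y | exists nu, asymptotic_binormal3 g q Y nu].

Definition binormal3 g q : set 'rV[R]_3 :=
  [set nu | exists Y, asymptotic_binormal3 g q Y nu].

End Surfaces3.

Section Projection.
Variable R : realType.

Definition proj_along (v z : 'rV[R]_4) : 'rV[R]_4 := z - dot z v *: v.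

Definition dir_v : 'rV[R]_4 := delta_mx 0 1.

(* The identification of the orthogonal complement of dir_v with R^3 by
   dropping the (zero) second coordinate; on normal vectors (0, 0, a, b) it is
   the identification of normal planes (0, 0, a, b) |-> (0, a, b). *)
Definition perp_coords (z : 'rV[R]_4) : 'rV[R]_3 := col' 1 z.

Definition monge_projection (f1 f2 : 'rV[R]_2 -> R) : 'rV[R]_2 -> 'rV[R]_3 :=
  fun z => perp_coords (proj_along dir_v (monge f1 f2 z)).

Lemma monge_projectionE (f1 f2 : 'rV[R]_2 -> R) (z : 'rV[R]_2) :
  monge_projection f1 f2 z = \row_i [:: z 0 0; f1 z; f2 z]`_i.
Proof.
have dE (a : 'rV[R]_4) : dot a dir_v = a 0 1.
  rewrite /dot (bigD1 1) //= mxE !eqxx mulr1 big1 ?addr0 // => i /negPf i1.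
  by rewrite mxE i1 andbF mulr0.
apply/rowP => i; rewrite !mxE dE !mxE /=.
case: i => -[|[|[|//]]] /= hi;
  by rewrite /bump /= ?add1n ?add0n /= mulr0 subr0.
Qed.

End Projection.

(* Main.v *)
(* Let X be the Monge parametrisation of N and, for a normal vector nu, let H_nu
   be the Hessian at 0 of the height function <X, nu>.  Any other parametrisation
   of N near 0 is X \o phi, where phi consists of its first two coordinates; as
   d<X, nu> vanishes at 0, its height function in direction nu has Hessian
   J H_nu J^T with J invertible.  Hence, independently of the parametrisation, Y
   is asymptotic for N iff Y H_nu = 0 for some normal nu <> 0 (the components of
   eta and eta' along such a nu both vanish), and nu is binormal iff det H_nu = 0.
   The second fundamental form of the projection, which loses only the second
   coordinate, is given by the same matrices H_nu, so its asymptotic and binormal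
   directions are characterised by the same equations. *)

Require Import Defs.
From HB Require Import structures.
From mathcomp Require Import all_boot all_order all_algebra.
From mathcomp Require Import all_classical all_reals all_analysis.
From mathcomp Require Import ring lra.

Set Implicit Arguments.
Unset Strict Implicit.
Unset Printing Implicit Defensive.

Import Order.TTheory GRing.Theory Num.Theory.
Import numFieldNormedType.Exports.

Local Open Scope classical_set_scope.
Local Open Scope card_scope.
Local Open Scope ring_scope.

(** * Twice differentiable maps *)

(** The first-order expansion at [x] depends only on the germ of the map and determines the
    differential, so that of [f] also serves for [g]. *)
Lemma near_eq_differentiable (R : realType) (V W : normedModType R)
    (f g : V -> W) (x : V) :
  (\near x, f x = g x) -> differentiable f x -> differentiable g x.
Proof.
move=> fg df.
have [cdf] := (diff_locallyP x f).1 df.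
move=> /eqaddoP dfo.
have dfg : g \o shift x = cst (g x) + 'd f x +o_ 0 id.
  apply/eqaddoP => e e0; have := dfo e e0.
  apply: filter_app.
  have fgx : \forall z \near 0, f (z + x) = g (z + x).
    by move: fg; rewrite (near_shift 0 x); apply: filterS => z /=; rewrite subr0.
  near=> z; rewrite /= !fctE /= => h.
  rewrite -(nbhs_singleton fg).
  have <- // : f (z + x) = g (z + x) by near: z.
have gE := diff_unique cdf dfg.
by apply/diff_locallyP; rewrite gE.
Unshelve. all: by end_near. Qed.

(** The first clause makes first derivatives computable on a neighbourhood of [x]; the second gives
    their first-order expansion at [x]. Symmetry of second derivatives and the second-order chain
    rule are derived from these two. *)
Definition twice_differentiable (R : realType) (V W : normedModType R)
    (f : V -> W) (x : V) : Prop :=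
  (\near x, differentiable f x) /\ forall w, differentiable ('D_w f) x.

Lemma smooth_on_twice (R : realType) (V W : normedModType R) (U : set V)
    (f : V -> W) (x : V) :
  open U -> U x -> smooth_on U f -> twice_differentiable f x.
Proof.
move=> oU Ux fS; split=> [|w]; last exact: (fS [:: w]).
near=> z; apply: (fS [::]); near: z; exact: open_nbhs_nbhs.
Unshelve. all: by end_near. Qed.

Section ContinuousLinear.
Context {R : realType} {V W W' : normedModType R}.
Variable L : {linear W -> W'}.
Hypothesis L_cont : continuous L.

Lemma derive_linear_comp (f : V -> W) (v x : V) :
  differentiable f x -> 'D_v (L \o f) x = L ('D_v f x).
Proof.
move=> df.
have dL z : differentiable L z by apply: linear_differentiable.
rewrite !deriveE //; last exact: differentiable_comp.
by rewrite diff_comp //= diff_lin.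
Qed.

Lemma derive2_linear_comp (f : V -> W) (v w x : V) :
  twice_differentiable f x ->
  'D_w ('D_v (L \o f)) x = L ('D_w ('D_v f) x).
Proof.
move=> [df d2f]; rewrite -derive_linear_comp //.
apply: near_eq_derive; near=> z; apply: derive_linear_comp.
by near: z.
Unshelve. all: by end_near. Qed.

Lemma twice_differentiable_linear_comp (f : V -> W) (x : V) :
  twice_differentiable f x -> twice_differentiable (L \o f) x.
Proof.
move=> [df d2f]; split=> [|w].
  near=> z; apply: differentiable_comp; first by near: z.
  exact: linear_differentiable.
apply: (@near_eq_differentiable _ _ _ (L \o 'D_w f)).
  near=> z; rewrite derive_linear_comp //; by near: z.
apply: differentiable_comp => //; exact: linear_differentiable.
Unshelve. all: by end_near. Qed.

End ContinuousLinear.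

(** [L] is a finite sum of coordinate functions times fixed vectors. *)
Lemma linear_row_continuous (R : realType) (n : nat) (W : normedModType R)
  (L : {linear 'rV[R]_n -> W}) : continuous L.
Proof.
move=> z; apply: differentiable_continuous.
have -> : (L : _ -> _) =
    \sum_i (fun z : 'rV[R]_n => z 0 i *: L (delta_mx 0 i)).
  apply/funext => y; rewrite fct_sumE {1}(row_sum_delta y) linear_sum.
  by apply: eq_bigr => i _; rewrite linearZ.
apply: differentiable_sum => i; apply: differentiableZl.
exact: differentiable_coord.
Qed.

(** * Symmetry of second derivatives *)

Lemma is_derive_line (R : realType) (V W : normedModType R) (F : V -> W)
    (a y : V) (s : R) :
  differentiable F (s *: a + y) ->
  is_derive s (1 : R) (fun r : R => F (r *: a + y)) ('D_a F (s *: a + y)).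
Proof.
move=> dF.
have dl : is_diff s (fun r : R => r *: a + y) ( *:%R ^~ a).
  have -> : (fun r : R => r *: a + y) = ( *:%R ^~ a) + cst y by [].
  by apply: is_diff_eq; rewrite addr0.
have dc : differentiable (F \o (fun r : R => r *: a + y)) s.
  exact: differentiable_comp.
have E : (fun r : R => F (r *: a + y)) = F \o (fun r : R => r *: a + y) by [].
rewrite E; apply: DeriveDef; first exact: diff_derivable.
by rewrite !deriveE // diff_comp // diff_val /= scale1r.
Qed.

(** The mean value theorem along [a] turns the second difference into [t] times an increment of
    ['D_a F]. Expanding ['D_a F] to first order at [x] evaluates that increment up to two
    remainders, each at most [e] times a displacement of order [t]. *)
Lemma second_difference (R : realType) (V : normedModType R) (F : V -> R)
    (x a b : V) (e : R) :
  twice_differentiable F x -> 0 < e ->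
  exists2 d, 0 < d & forall t, 0 < t < d ->
  `|F (t *: a + (t *: b + x)) - F (t *: a + x) - F (t *: b + x) + F x
    - t ^+ 2 * 'D_b ('D_a F) x| <= e * t ^+ 2 * (2 * `|a| + `|b|).
Proof.
move=> [dF d2F] e0; set G := 'D_a F.
have dG : differentiable G x := d2F a.
have : \forall h \near (0 : V), differentiable F (h + x) /\
    `|G (h + x) - (G x + 'd G x h)| <= e * `|h|.
  near=> h; split.
    near: h; move: dF; rewrite (near_shift 0 x).
    by apply: filterS => z /=; rewrite subr0.
  near: h.
  exact: ((eqaddoP _ _ _ _).1 (diff_locally dG) e e0).
move=> /nbhs_normP[d /= d0 dP].
have P h : `|h| < d -> differentiable F (h + x) /\
    `|G (h + x) - (G x + 'd G x h)| <= e * `|h|.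
  by move=> hd; apply: dP; rewrite /= sub0r normrN.
have ab0 : 0 < `|a| + `|b| + 1 by rewrite ltr_wpDl // addr_ge0.
(* The [+ 1] keeps the denominator positive when [a = b = 0]. For [t] below this bound, every point
   used lies within distance [d] of [x]. *)
exists (d / (`|a| + `|b| + 1)); first exact: divr_gt0.
move=> t /andP[t0]; rewrite ltr_pdivlMr // => td.
have tt : 0 <= t <= t by rewrite lexx ltW.
have t00 : 0 <= (0 : R) <= t by rewrite lexx ltW.
have small c k : 0 <= c <= t -> 0 <= k <= t ->
    `|c *: a + k *: b| <= c * `|a| + k * `|b| < d.
  move=> /andP[c0 ct] /andP[k0 kt]; apply/andP; split.
    by rewrite (le_trans (ler_normD _ _)) // !normrZ !ger0_norm.
  apply: le_lt_trans td; rewrite !mulrDr mulr1.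
  by have := ler_wpM2r (normr_ge0 a) ct; have := ler_wpM2r (normr_ge0 b) kt; lra.
pose phi s := F (s *: a + (t *: b + x)) - F (s *: a + x).
pose dphi s := G (s *: a + (t *: b + x)) - G (s *: a + x).
have dphiP s : 0 <= s <= t -> is_derive s (1 : R) phi (dphi s).
  move=> st; apply: is_deriveB; apply: is_derive_line.
    rewrite addrA; apply: (P _ _).1.
    by have [n l] := andP (small s t st tt); exact: le_lt_trans n l.
  apply: (P _ _).1.
  have [n l] := andP (small s 0 st t00).
  by move: n; rewrite scale0r addr0 => n; exact: le_lt_trans n l.
have [||c ct] := @MVT_segment R phi dphi 0 t (ltW t0).
- by move=> s /itvP st; apply: dphiP; rewrite !st.
- apply: derivable_within_continuous => s /itvP st.
  by have [] : is_derive s (1 : R) phi (dphi s) by apply: dphiP; rewrite !st.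
have {}ct : 0 <= c <= t by rewrite !(itvP ct).
rewrite /phi subr0 !scale0r !add0r => E.
have -> : F (t *: a + (t *: b + x)) - F (t *: a + x) - F (t *: b + x) + F x
    - t ^+ 2 * 'D_b G x = t * (dphi c - t * 'D_b G x).
  by rewrite mulrBr [t * dphi c]mulrC -E; ring.
have [n1 l1] := andP (small c t ct tt).
have [n2 l2] := andP (small c 0 ct t00).
have [_ P1] := P _ (le_lt_trans n1 l1).
have [_ P2] := P _ (le_lt_trans n2 l2).
rewrite normrM (gtr0_norm t0) expr2.
suff : `|dphi c - t * 'D_b G x| <= e * t * (2 * `|a| + `|b|).
  have -> : e * (t * t) * (2 * `|a| + `|b|) = t * (e * t * (2 * `|a| + `|b|)).
    by ring.
  exact: ler_wpM2l (ltW t0) _ _.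
(* By linearity of ['d G x], the error is a difference of two expansion remainders of [G]. The term
   [0 *: b] is kept so that [small] bounds both displacements. *)
have -> : dphi c - t * 'D_b G x =
    (G (c *: a + t *: b + x) - (G x + 'd G x (c *: a + t *: b))) -
    (G (c *: a + 0 *: b + x) - (G x + 'd G x (c *: a + 0 *: b))).
  have -> : 'd G x (c *: a + t *: b) = 'd G x (c *: a) + t * 'd G x b.
    by rewrite linearD [X in _ + X]linearZ.
  by rewrite /dphi deriveE // scale0r addr0 addrA; ring.
apply: le_trans (ler_normB _ _) _.
apply: le_trans (lerD P1 P2) _.
rewrite -mulrDr -mulrA ler_pM2l //.
apply: le_trans (lerD n1 n2) _.
have /andP[_ ct'] := ct.
have := ler_wpM2r (normr_ge0 a) ct'; lra.
Unshelve. all: by end_near. Qed.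

(* The second difference of [second_difference] is symmetric in [a] and [b]. *)
Lemma derive_comm (R : realType) (V : normedModType R) (F : V -> R)
    (x a b : V) :
  twice_differentiable F x -> 'D_b ('D_a F) x = 'D_a ('D_b F) x.
Proof.
move=> F2; apply/eqP; rewrite -subr_eq0 -normr_le0.
apply/ler_addgt0Pl => e e0; rewrite addr0.
(* The two error bounds add up to the factor [3 * (|a| + |b|)]; the [+ 1] makes [k] positive, so
   that accuracy [e / k] is enough. *)
set k := 3 * (`|a| + `|b|) + 1.
have k0 : 0 < k by rewrite ltr_wpDl // mulr_ge0 // addr_ge0.
have ek0 : 0 < e / k by exact: divr_gt0.
have [d1 d10 P1] := second_difference a b F2 ek0.
have [d2 d20 P2] := second_difference b a F2 ek0.
have m0 : 0 < Num.min d1 d2 by rewrite lt_min d10.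
pose t := Num.min d1 d2 / 2.
have t0 : 0 < t by exact: divr_gt0.
have tm : t < Num.min d1 d2 by rewrite /t; lra.
have td1 : 0 < t < d1 by rewrite t0 (lt_le_trans tm) // ge_min lexx.
have td2 : 0 < t < d2 by rewrite t0 (lt_le_trans tm) // ge_min lexx orbT.
have {}P1 := P1 t td1; have {}P2 := P2 t td2.
have t20 : 0 < t ^+ 2 by rewrite exprn_gt0.
rewrite -(ler_pM2l t20) -{1}(gtr0_norm t20) -normrM.
set A := 'D_b ('D_a F) x in P1 *; set B := 'D_a ('D_b F) x in P2 *.
(* Both orders give the same second difference, so only the two error terms remain. *)
have -> : t ^+ 2 * (A - B) =
   (F (t *: b + (t *: a + x)) - F (t *: b + x) - F (t *: a + x) + F x - t ^+ 2 * B)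
 - (F (t *: a + (t *: b + x)) - F (t *: a + x) - F (t *: b + x) + F x - t ^+ 2 * A).
  rewrite (addrCA (t *: b)); ring.
apply: le_trans (ler_normB _ _) _.
apply: le_trans (lerD P2 P1) _.
rewrite -mulrDr [e / k * _]mulrC -mulrA ler_pM2l //.
rewrite -mulrA ger_pMr // mulrC ler_pdivrMr // mul1r /k.
move: `|a| `|b|; clear=> p q; lra.
Qed.

(** * Second-order chain rule at a critical point *)

Lemma diff_row (R : realType) (n : nat) (W : normedModType R)
    (f : 'rV[R]_n -> W) (x v : 'rV[R]_n) :
  differentiable f x ->
  'd f x v = \sum_j v 0 j *: 'D_(delta_mx 0 j) f x.
Proof.
move=> df; rewrite {1}(row_sum_delta v) linear_sum; apply: eq_bigr => j _.
by rewrite linearZ deriveE.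
Qed.

(** Near [u] the first derivative is a sum of products [c i * (G i \o phi)]. Differentiating again,
    the terms with second derivatives of [phi] carry a factor [G i (phi u)], which vanishes at a
    critical point of [F]. *)
Lemma derive2_comp (R : realType) (m n : nat) (F : 'rV[R]_n -> R)
    (phi : 'rV[R]_m -> 'rV[R]_n) (u v w : 'rV[R]_m) :
  twice_differentiable phi u -> twice_differentiable F (phi u) ->
  (forall z, 'd F (phi u) z = 0) ->
  'D_w ('D_v (F \o phi)) u =
  \sum_i \sum_j 'D_v phi u 0 i * 'D_w phi u 0 j *
    'D_(delta_mx 0 j) ('D_(delta_mx 0 i) F) (phi u).
Proof.
move=> [dphi d2phi] [dF d2F] dF0.
have dphiu : differentiable phi u by exact: nbhs_singleton dphi.
have dFu : differentiable F (phi u) by exact: nbhs_singleton dF.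
have cphi : {for u, continuous phi} by exact: differentiable_continuous.
pose G i := 'D_(delta_mx 0 i) F.
pose c i z : R := 'D_v phi z 0 i.
have dc i : differentiable (c i) u.
  have -> : c i = (fun y : 'rV[R]_n => y 0 i) \o 'D_v phi by [].
  apply: differentiable_comp; first exact: d2phi.
  exact: differentiable_coord.
have dG i : differentiable (G i \o phi) u.
  by apply: differentiable_comp => //; exact: d2F.
have E : \near u, 'D_v (F \o phi) u = (\sum_i (c i * (G i \o phi))) u.
  have dFphi : \forall z \near u, differentiable F (phi z).
    exact: (cphi _ dF).
  near=> z.
  have dz : differentiable phi z by near: z.
  have dFz : differentiable F (phi z) by near: z.
  rewrite fct_sumE deriveE; last exact: differentiable_comp.
  rewrite (diff_comp dz dFz) [LHS](diff_row _ dFz).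
  by apply: eq_bigr => i _; rewrite -(deriveE _ dz).
rewrite (near_eq_derive _ E) derive_sum; last first.
  by move=> i; apply: derivableM; exact: diff_derivable.
apply: eq_bigr => i _.
rewrite deriveM; [|exact: diff_derivable..].
have -> : (G i \o phi) u = 0 by rewrite /G /= deriveE // dF0.
rewrite scale0r addr0 (deriveE _ (dG i)) (diff_comp dphiu (d2F _)).
rewrite [X in _ *: X](diff_row _ (d2F _)) scaler_sumr; apply: eq_bigr => j _.
by rewrite -(deriveE _ dphiu) /c -mulrA.
Unshelve. all: by end_near. Qed.

(** * Scalar products and Hessians of height functions *)

Lemma sum_ord2 (V : nmodType) (F : 'I_2 -> V) : \sum_i F i = F 0 + F 1.
Proof.
rewrite !big_ord_recl big_ord0 addr0.
by have -> : lift ord0 ord0 = 1 :> 'I_2 by apply: val_inj.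
Qed.

Lemma dot2 (R : realType) (a b : 'rV[R]_2) :
  dot a b = a 0 0 * b 0 0 + a 0 1 * b 0 1.
Proof. exact: sum_ord2. Qed.

(** The fixed factor comes first so that [dotr b] can be declared a linear map. *)
Definition dotr (R : realType) (n : nat) (b a : 'rV[R]_n) : R := dot a b.

Lemma dotr_is_linear (R : realType) (n : nat) (b : 'rV[R]_n) :
  linear (dotr b : 'rV[R]_n -> R^o).
Proof.
move=> k x y; rewrite /dotr /dot scaler_sumr -big_split /=.
by apply: eq_bigr => i _; rewrite !mxE mulrDl -mulrA.
Qed.

HB.instance Definition _ (R : realType) (n : nat) (b : 'rV[R]_n) :=
  GRing.isLinear.Build R 'rV[R]_n R^o _ (dotr b) (dotr_is_linear b).

Lemma dotr_continuous (R : realType) (n : nat) (b : 'rV[R]_n) :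
  continuous (dotr b).
Proof. exact: (@linear_row_continuous R n R^o). Qed.

Lemma dotE (R : realType) (n : nat) (a b : 'rV[R]_n) :
  dot a b = (a *m b^T) 0 0.
Proof. by rewrite /dot mxE; apply: eq_bigr => i _; rewrite mxE. Qed.

Lemma dotC (R : realType) (n : nat) (a b : 'rV[R]_n) : dot a b = dot b a.
Proof. by apply: eq_bigr => i _; rewrite mulrC. Qed.

Lemma dotDl (R : realType) (n : nat) (a b c : 'rV[R]_n) :
  dot (a + b) c = dot a c + dot b c.
Proof. by rewrite !dotE mulmxDl mxE. Qed.

Lemma dotZl (R : realType) (n : nat) k (a c : 'rV[R]_n) :
  dot (k *: a) c = k * dot a c.
Proof. by rewrite !dotE -scalemxAl mxE. Qed.

Lemma dotDr (R : realType) (n : nat) (a b c : 'rV[R]_n) :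
  dot c (a + b) = dot c a + dot c b.
Proof. by rewrite dotC dotDl !(dotC _ c). Qed.

Lemma dotZr (R : realType) (n : nat) k (a c : 'rV[R]_n) :
  dot c (k *: a) = k * dot c a.
Proof. by rewrite dotC dotZl (dotC _ c). Qed.

Lemma dot_row_mx (R : realType) (m n : nat) (a c : 'rV[R]_m) (b d : 'rV[R]_n) :
  dot (row_mx a b) (row_mx c d) = dot a c + dot b d.
Proof. by rewrite !dotE tr_row_mx mul_row_col mxE. Qed.

Lemma hessian_sym (R : realType) (h : 'rV[R]_2 -> R) (u : 'rV[R]_2) i j :
  twice_differentiable h u -> hessian h u i j = hessian h u j i.
Proof. by move=> h2; rewrite !mxE; exact: derive_comm. Qed.

Lemma height_twice (R : realType) (X : 'rV[R]_2 -> 'rV[R]_4) nu u :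
  twice_differentiable X u -> twice_differentiable (height X nu) u.
Proof.
move=> X2; exact: (twice_differentiable_linear_comp (@dotr_continuous R 4 nu)).
Qed.

Lemma hessian_dot (R : realType) n (X : 'rV[R]_2 -> 'rV[R]_n) nu u i j :
  twice_differentiable X u ->
  hessian (fun z => dot (X z) nu) u i j = dot (partial i (partial j X) u) nu.
Proof.
move=> X2; rewrite mxE.
exact: (derive2_linear_comp (@dotr_continuous R n nu)).
Qed.

(** Matrix form of [derive2_comp]. The rows of [J] are the partial derivatives of [phi], so [J] is
    the transposed Jacobian and acts on row vectors from the right. *)
Lemma hessian_comp (R : realType) (F : 'rV[R]_2 -> R)
    (phi : 'rV[R]_2 -> 'rV[R]_2) (u : 'rV[R]_2) :
  twice_differentiable phi u -> twice_differentiable F (phi u) ->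
  (forall z, 'd F (phi u) z = 0) ->
  let J := \matrix_(i < 2) partial i phi u in
  hessian (F \o phi) u = J *m hessian F (phi u) *m J^T.
Proof.
move=> phi2 F2 dF0 J; apply/matrixP => i j.
rewrite !mxE [LHS]derive2_comp //; apply: eq_bigr => k _.
rewrite !mxE mulr_suml; apply: eq_bigr => l _.
by rewrite !mxE /partial [RHS]mulrC mulrA.
Qed.

Lemma hessian_near (R : realType) (F G : 'rV[R]_2 -> R) (u : 'rV[R]_2) :
  (\near u, F u = G u) -> hessian F u = hessian G u.
Proof.
move=> FG; apply/matrixP => i j; rewrite !mxE.
apply: near_eq_derive.
(* Equality near [u] also holds near each point close to [u], so the first derivatives agree on a
   neighbourhood. *)
have : \forall z \near u, \forall y \near z, F y = G y by exact: near_join.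
by apply: filterS => z; exact: near_eq_derive.
Qed.

(** * Independence of the parametrisation *)

Lemma lp_twice (R : realType) (N : set 'rV[R]_4) p X U u :
  local_parametrisation N p X U u -> twice_differentiable X u.
Proof. by case=> oU Uu _ XS _ _; exact: smooth_on_twice oU Uu XS. Qed.

Lemma dot_row_mx0 (R : realType) (m n : nat) (a : 'rV[R]_m)
    (b : 'rV[R]_(m + n)) : dot (row_mx a 0) b = dot a (lsubmx b).
Proof.
by rewrite -{1}[b]hsubmxK dot_row_mx [X in _ + X]dotE mul0mx mxE addr0.
Qed.

Section Graph.
Context {R : realType}.
Variables (N : set 'rV[R]_4) (X0 : 'rV[R]_2 -> 'rV[R]_4) (U0 : set 'rV[R]_2).
Hypothesis X0_graph : forall z, lsubmx (X0 z : 'rV[R]_(2 + 2)) = z.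
Hypothesis X0_tangent :
  forall w, 'd X0 0 w = (row_mx w 0 : 'rV[R]_(2 + 2)) :> 'rV[R]_4.
Hypothesis X0_param : local_parametrisation N 0 X0 U0 0.

Let T : 'rV[R]_4 -> 'rV[R]_2 := @lsubmx R 1 2 2.

(** By continuity [X] stays in the open set [W0], where [N] is the image of [X0], and [T] is a left
    inverse of [X0]. Thus [T \o X] is the change of coordinates. *)
Lemma near_graph X U u : local_parametrisation N 0 X U u ->
  \forall z \near u, X z = X0 (T (X z)).
Proof.
move=> lpX; have [oU Uu Xu _ _ [W [Y [oW XU _ _]]]] := lpX.
have [_ _ X00 _ _ [W0 [Y0 [oW0 XU0 _ _]]]] := X0_param.
have cX : {for u, continuous X}.
  exact: differentiable_continuous (nbhs_singleton (lp_twice lpX).1).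
have W00 : W0 (X u).
  have : (N `&` W0) (X0 0) by rewrite -XU0; exists 0 => //; have [] := X0_param.
  by rewrite X00 Xu => -[].
have nW0 : \forall z \near u, W0 (X z).
  exact: (cX W0 (open_nbhs_nbhs (conj oW0 W00))).
have nU : \forall z \near u, U z by exact: (open_nbhs_nbhs (conj oU Uu)).
near=> z.
have : (N `&` W0) (X z).
  split; last by near: z.
  have : (X @` U) (X z) by exists z => //; near: z.
  by rewrite XU => -[].
by rewrite -XU0 => -[y _ <-]; rewrite /T X0_graph.
Unshelve. all: by end_near. Qed.

(** The image of ['d X0 0] is the plane of the first two coordinates, to which [nu] is
    orthogonal. *)
Lemma height_critical nu : lsubmx (nu : 'rV[R]_(2 + 2)) = 0 ->
  forall z, 'd (height X0 nu) 0 z = 0.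
Proof.
move=> nu0 z.
have [dX _] := lp_twice X0_param.
have dX0 := nbhs_singleton dX.
have [dh _] := height_twice nu (lp_twice X0_param).
rewrite -(deriveE _ (nbhs_singleton dh)).
rewrite [LHS](derive_linear_comp (@dotr_continuous R 4 nu)) //.
rewrite /= /dotr (deriveE _ dX0) X0_tangent.
by rewrite [LHS](@dot_row_mx0 R 2 2 z nu) nu0 dotE trmx0 mulmx0 mxE.
Qed.

(** [J] is the transposed Jacobian of [T \o X] at [u]. Restricting to normal [nu] makes the height
    function of [X0] critical, as [hessian_comp] requires. *)
Lemma change_of_parametrisation X U u : local_parametrisation N 0 X U u ->
  exists J : 'M[R]_2,
  [/\ J \in unitmx,
      forall w, 'd X u w = (row_mx (w *m J) 0 : 'rV[R]_(2 + 2)) :> 'rV[R]_4 &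
      forall nu, lsubmx (nu : 'rV[R]_(2 + 2)) = 0 ->
        hessian (height X nu) u = J *m hessian (height X0 nu) 0 *m J^T].
Proof.
move=> lpX; have X2 := lp_twice lpX; have X02 := lp_twice X0_param.
have [_ _ Xu _ Xinj _] := lpX.
have phi2 : twice_differentiable (T \o X) u.
  exact: (twice_differentiable_linear_comp (@continuous_lsubmx R 1 2 2)).
have phiu : (T \o X) u = 0 by rewrite /T /= Xu raddf0.
have nX := near_graph lpX.
have dX : differentiable X u := nbhs_singleton X2.1.
have dphi : differentiable (T \o X) u := nbhs_singleton phi2.1.
have dX0 : differentiable X0 0 := nbhs_singleton X02.1.
exists (\matrix_(i < 2) partial i (T \o X) u).
set J := \matrix_(i < 2) _.
have dXE w : 'd X u w = (row_mx (w *m J) 0 : 'rV[R]_(2 + 2)) :> 'rV[R]_4.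
  rewrite -(deriveE _ dX) (near_eq_derive (g := X0 \o (T \o X))) //.
  have dX0' : differentiable X0 ((T \o X) u) by rewrite phiu.
  rewrite deriveE; last exact: differentiable_comp.
  rewrite (diff_comp dphi dX0') phiu /= X0_tangent.
  have -> // : 'd (T \o X) u w = w *m J.
  rewrite diff_row // mulmx_sum_row.
  by apply: eq_bigr => j _; rewrite rowK.
split=> [|//|nu nu0].
  (* A nonzero [v] with [v *m J = 0] would be killed by ['d X u], against the immersion property. *)
  rewrite unitmxE unitfE; apply/negP => /det0P[v v0 vJ].
  have : 'd X u v = 'd X u 0 by rewrite !dXE vJ mul0mx.
  move/(Xinj _ _) => /= vE; case/negP: v0; apply/eqP; apply: vE.
  by have [] := lpX.
rewrite (hessian_near (G := height X0 nu \o (T \o X))); last first.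
  by apply: filterS nX => z Xz; rewrite /height /= -Xz.
have h2 := height_twice nu X02.
rewrite -[in RHS]phiu; apply: hessian_comp => //; rewrite phiu //.
exact: height_critical.
Qed.

End Graph.

(** * Linear dependence in the curvature ellipse *)

Lemma dot_self_eq0 (R : realType) (n : nat) (a : 'rV[R]_n) :
  dot a a = 0 -> a = 0.
Proof.
move=> /eqP; rewrite /dot psumr_eq0; last by move=> i _; rewrite -expr2 sqr_ge0.
move=> /allP a0; apply/rowP => i; rewrite mxE; apply/eqP.
by have := a0 i (mem_index_enum _); rewrite mulf_eq0 orbb.
Qed.

(** The angle [acos x] has sine [|y|]; its opposite serves when [y] is negative. *)
Lemma circle_param (R : realType) (x y : R) : x ^+ 2 + y ^+ 2 = 1 ->
  exists t, cos t = x /\ sin t = y.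
Proof.
move=> xy; have xB : -1 <= x <= 1.
  by rewrite -ler_norml -(@expr_le1 _ 2) // real_normK ?num_real // -xy lerDl sqr_ge0.
have cx : cos (acos x) = x by rewrite acosK // in_itv.
have sx : sin (acos x) = `|y|.
  rewrite sin_acos // -sqrtr_sqr; congr Num.sqrt; by rewrite -xy addrC addKr.
case: (leP 0 y) => y0; first by exists (acos x); rewrite sx ger0_norm.
by exists (- acos x); rewrite cosN sinN sx ltr0_norm // opprK.
Qed.

(** The orthogonal of a nonzero [(a, b)] in the plane is the line spanned by [(- b, a)]. The factor
    for [(p, q)] is its scalar product with [(- b, a)] divided by [a ^+ 2 + b ^+ 2]. *)
Lemma kernel2 (R : realFieldType) (x0 x1 y0 y1 a b : R) :
  (a != 0) || (b != 0) -> a * x0 + b * x1 = 0 -> a * y0 + b * y1 = 0 ->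
  exists k l, [/\ x0 = - k * b, x1 = k * a, y0 = - l * b & y1 = l * a].
Proof.
move=> ab0 ax ay; pose d := a ^+ 2 + b ^+ 2.
have d0 : d != 0 by rewrite paddr_eq0 ?sqr_ge0 // !expf_eq0 /= negb_and.
have solve p q : a * p + b * q = 0 ->
    p = - ((a * q - b * p) / d) * b /\ q = (a * q - b * p) / d * a.
  move=> pq; have ap : a * p = - (b * q) by apply/eqP; rewrite -addr_eq0 pq.
  set k := _ / d; have kd : k * d = a * q - b * p by rewrite divfK.
  split; apply: (mulIf d0).
    have -> : - k * b * d = - (k * d) * b by ring.
    have -> : p * d = a * (a * p) + b ^+ 2 * p by rewrite /d; ring.
    by rewrite kd ap; ring.
  have -> : k * a * d = k * d * a by ring.
  have -> : (k * d) * a = a ^+ 2 * q - b * (a * p) by rewrite kd; ring.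
  by rewrite ap /d; ring.
by have [? ?] := solve _ _ ax; have [? ?] := solve _ _ ay;
  exists ((a * x1 - b * x0) / d), ((a * y1 - b * y0) / d).
Qed.

(** Two vectors of a plane are dependent iff some nonzero linear form kills both; [a] and [b] are
    the values of that form on the basis [u], [v]. *)
Lemma free2P (R : realFieldType) (V : vectType R) (u v : V)
    (x0 x1 y0 y1 : R) : free [:: u; v] ->
  ~~ free [:: x0 *: u + x1 *: v; y0 *: u + y1 *: v] <->
  exists a b, [/\ (a != 0) || (b != 0), a * x0 + b * x1 = 0 &
                  a * y0 + b * y1 = 0].
Proof.
move=> uv.
have inj (p0 p1 q0 q1 : R) : p0 *: u + p1 *: v = q0 *: u + q1 *: v ->
    p0 = q0 /\ p1 = q1.
  move/eqP; rewrite -subr_eq0 opprD addrACA -!scalerBl => /eqP E.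
  move/freeP: uv => /(_ (fun i => [:: p0 - q0; p1 - q1]`_i)).
  rewrite !big_ord_recl big_ord0 /= addr0 => /(_ E) F.
  have := F ord0; have := F (lift ord0 ord0); rewrite /=.
  by move=> /eqP; rewrite subr_eq0 => /eqP -> /eqP; rewrite subr_eq0 => /eqP ->.
rewrite free_cons seq1_free span_seq1 negb_and !negbK; split.
  case/orP=> [/vlineP[k]|/eqP].
    rewrite scalerDr !scalerA => /inj[-> ->].
    (* The form [(y1, - y0)] kills the second vector and its multiples. If it is zero, both vectors
       vanish and any nonzero form works. *)
    case: (boolP ((y1 != 0) || (y0 != 0))) => y01.
      by exists y1, (- y0); rewrite oppr_eq0; split => //; ring.
    move: y01; rewrite negb_or !negbK => /andP[/eqP -> /eqP ->].
    by exists 1, 0; rewrite oner_neq0; split => //; ring.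
  have {1}-> : (0 : V) = 0 *: u + 0 *: v by rewrite !scale0r addr0.
  move=> /inj[-> ->].
  case: (boolP ((x1 != 0) || (x0 != 0))) => x01.
    by exists x1, (- x0); rewrite oppr_eq0; split => //; ring.
  move: x01; rewrite negb_or !negbK => /andP[/eqP -> /eqP ->].
  by exists 1, 0; rewrite oner_neq0; split => //; ring.
move=> [a [b [ab0 ax ay]]].
have [k [l [-> -> -> ->]]] := kernel2 ab0 ax ay.
case: (eqVneq l 0) => [->|l0].
  by rewrite oppr0 !mul0r !scale0r addr0 eqxx orbT.
apply/orP; left; apply/vlineP; exists (k / l).
by rewrite scalerDr !scalerA !mulNr !mulrN !mulrA !divfK.
Qed.

(** An injective [L] maps lines injectively to lines, and the two conditions make it send the lines
    of [B] onto those of [A]. The scalar [c] is there because [A] may contain only normalised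
    representatives, as [asymptotic] does. *)
Lemma directions_card_eq (R : realType) (m n : nat)
    (L : {linear 'rV[R]_m -> 'rV[R]_n}) (A : set 'rV[R]_n) (B : set 'rV[R]_m) :
  injective L ->
  (forall a, A a -> exists2 b, B b & a = L b) ->
  (forall b, B b -> exists2 c, c != 0 & A (L (c *: b))) ->
  directions A #= directions B.
Proof.
move=> Linj AB BA.
have L0 : lker (linfun L) == 0%VS.
  by apply/lker0P => x y; rewrite !lfunE => /Linj.
have -> : directions A = [set (linfun L @: V)%VS | V in directions B].
  rewrite /directions image_comp; apply/seteqP; split=> U [a].
    move=> /AB[b Bb ->] <-; exists b => //=.
    by rewrite limg_line lfunE.
  move=> Ba <-; have [c c0 Ac] := BA _ Ba; exists (L (c *: a)) => //=.
  rewrite limg_line lfunE /= linearZ; apply/eqP; rewrite eqEsubv -!memvE.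
  rewrite memvZ ?memv_line //= -[X in X \in _]scale1r -(mulVf c0) -scalerA.
  by rewrite memvZ // memv_line.
apply: inj_card_eq => V W _ _ /= VW; apply/eqP.
by rewrite -(eq_limg_ker0 _ _ L0) VW.
Qed.

Lemma row2_mulmx (R : realType) (v : 'rV[R]_2) (H : 'M[R]_2) j :
  (v *m H) 0 j = v 0 0 * H 0 j + v 0 1 * H 1 j.
Proof.
by rewrite mxE sum_ord2.
Qed.

Lemma ord2P (P : 'I_2 -> Prop) : P 0 -> P 1 -> forall i, P i.
Proof.
move=> P0 P1 [k]; case: k => [|[|k]] i2 //.
  by have -> : Ordinal i2 = 0 by apply: val_inj.
by have -> : Ordinal i2 = 1 by apply: val_inj.
Qed.

(** * The curvature ellipse in an adapted frame *)

Section Frame.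
Context {R : realType}.
Variables (X : 'rV[R]_2 -> 'rV[R]_4) (u : 'rV[R]_2) (e : 'I_(2 + 2) -> 'rV[R]_4).
Hypothesis X2 : twice_differentiable X u.
Hypothesis frame : adapted_frame X u e.

Let e3 := e (rshift 2 0).
Let e4 := e (rshift 2 1).
Let H nu := hessian (height X nu) u.

Lemma frame_free : free [:: e3; e4].
Proof.
have [on _] := frame.
apply/(@freeP _ _ _ [tuple e3; e4]) => k.
rewrite sum_ord2 /= => k0.
have dk nu : k 0 * dot e3 nu + k 1 * dot e4 nu = 0.
  by rewrite -!dotZl -dotDl k0 dotE mul0mx mxE.
apply: ord2P.
  by have := dk e3; rewrite !on /= mulr1 mulr0 addr0.
by have := dk e4; rewrite !on /= mulr1 mulr0 add0r.
Qed.

Lemma hessian_height nu i j :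
  H nu i j = dot (partial i (partial j X) u) nu.
Proof. exact: hessian_dot. Qed.

Let h nu i j := dot (partial i (partial j X) u) nu.
Let q nu (c s : R) := h nu 0 0 * c ^+ 2 + 2 * h nu 1 0 * c * s + h nu 1 1 * s ^+ 2.
(** The derivative of [q nu] along the unit circle, where [c' = - s] and [s' = c]. *)
Let dq nu (c s : R) :=
  2 * (h nu 1 0 * (c ^+ 2 - s ^+ 2) + (h nu 1 1 - h nu 0 0) * c * s).

Lemma curvature_ellipseE t : curvature_ellipse X u e t =
  q e3 (cos t) (sin t) *: e3 + q e4 (cos t) (sin t) *: e4.
Proof.
by rewrite /curvature_ellipse /second_ff sum_ord2.
Qed.

Lemma derive_curvature_ellipse t : derive1 (curvature_ellipse X u e) t =
  dq e3 (cos t) (sin t) *: e3 + dq e4 (cos t) (sin t) *: e4.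
Proof.
have -> : curvature_ellipse X u e =
    (fun t => q e3 (cos t) (sin t) *: e3) + (fun t => q e4 (cos t) (sin t) *: e4).
  by apply/funext => s; rewrite curvature_ellipseE.
have dqP nu : is_derive t (1 : R) (fun t => q nu (cos t) (sin t)) (dq nu (cos t) (sin t)).
  rewrite /q /dq.
  apply: is_derive_eq.
  move: (h nu 0 0) (h nu 1 0) (h nu 1 1) (cos t) (sin t); clear=> a b c x y.
  by rewrite -![_ *: _]/(_ * _); ring.
rewrite derive1E.
have dZ nu (v : 'rV[R]_4) : is_derive t (1 : R) (fun t => q nu (cos t) (sin t) *: v)
    (dq nu (cos t) (sin t) *: v).
  have [d1 d2] := dqP nu.
  have df : differentiable (fun t => q nu (cos t) (sin t)) t by exact/derivable1_diffP.
  apply: DeriveDef; first exact/diff_derivable/differentiableZl.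
  by rewrite deriveE ?diffZl -?deriveE // ?d2 //; exact: differentiableZl.
have [_ E] := is_deriveD (dZ e3 e3) (dZ e4 e4). exact: E.
Qed.

(** By [free2P], dependence means that [q nu] and [dq nu] vanish at [v] for some nonzero
    [nu = a *: e3 + b *: e4]. These numbers are the pairing of [v *m H nu] with [v = (c, s)] and
    twice its pairing with [(- s, c)]; as these two vectors form a basis, [v *m H nu = 0]. *)
Lemma dependent_frame (t : R) (v : 'rV[R]_2) :
  v 0 0 = cos t -> v 0 1 = sin t ->
  ~~ free [:: curvature_ellipse X u e t; derive1 (curvature_ellipse X u e) t] <->
  exists a b, ((a != 0) || (b != 0)) /\ v *m H (a *: e3 + b *: e4) = 0.
Proof.
move=> v0 v1.
rewrite curvature_ellipseE derive_curvature_ellipse.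
rewrite (free2P _ _ _ _ frame_free) -v0 -v1.
have cs : v 0 0 ^+ 2 + v 0 1 ^+ 2 = 1 by rewrite v0 v1 cos2Dsin2.
have hE a b i j : h (a *: e3 + b *: e4) i j = a * h e3 i j + b * h e4 i j.
  by rewrite /h dotDr !dotZr.
have vE a b : v *m H (a *: e3 + b *: e4) = 0 <->
    v 0 0 * h (a *: e3 + b *: e4) 0 0 + v 0 1 * h (a *: e3 + b *: e4) 1 0 = 0 /\
    v 0 0 * h (a *: e3 + b *: e4) 1 0 + v 0 1 * h (a *: e3 + b *: e4) 1 1 = 0.
  set nu := a *: e3 + b *: e4.
  have r0 : (v *m H nu) 0 0 = v 0 0 * h nu 0 0 + v 0 1 * h nu 1 0.
    by rewrite row2_mulmx (hessian_height nu 0 0) (hessian_height nu 1 0).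
  have r1 : (v *m H nu) 0 1 = v 0 0 * h nu 1 0 + v 0 1 * h nu 1 1.
    rewrite row2_mulmx (hessian_height nu 1 1); congr (_ * _ + _).
    rewrite -[RHS](hessian_height nu 1 0); exact: (hessian_sym 0 1 (height_twice nu X2)).
  split=> [vH|[z0 z1]].
    by split; [apply: etrans (esym r0) _|apply: etrans (esym r1) _]; rewrite vH mxE.
  apply/rowP; apply: ord2P; rewrite [RHS]mxE.
    exact: etrans r0 z0.
  exact: etrans r1 z1.
clear X2 frame; clearbody h.
have qE a b : a * q e3 (v 0 0) (v 0 1) + b * q e4 (v 0 0) (v 0 1) =
    q (a *: e3 + b *: e4) (v 0 0) (v 0 1).
  rewrite /q !(hE a b).
  by move: (h e3) (h e4) (v 0 0) (v 0 1) => f g c s; ring.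
have dqE a b : a * dq e3 (v 0 0) (v 0 1) + b * dq e4 (v 0 0) (v 0 1) =
    dq (a *: e3 + b *: e4) (v 0 0) (v 0 1).
  rewrite /dq !(hE a b).
  by move: (h e3) (h e4) (v 0 0) (v 0 1) => f g c s; ring.
split=> -[a [b]].
  rewrite qE dqE => -[ab0 q0 dq0]; exists a, b; split=> //; apply/vE.
  move: q0 dq0 cs; rewrite /q /dq; move: (h _ 0 0) (h _ 1 0) (h _ 1 1).
  move: (v 0 0) (v 0 1) => c s h00 h10 h11 {}q0 dq0 cs.
  have P0 : c * (c * h00 + s * h10) + s * (c * h10 + s * h11) = 0.
    by rewrite -[RHS]q0; ring.
  have Q0 : c * (c * h10 + s * h11) - s * (c * h00 + s * h10) = 0.
    apply: (mulfI (_ : 2 != 0 :> R)); first by rewrite pnatr_eq0.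
    by rewrite mulr0 -[RHS]dq0; ring.
  (* The components of [v *m H nu] are recovered from its pairings with [(c, s)] and [(- s, c)] by
     the inverse rotation, using [c ^+ 2 + s ^+ 2 = 1]. *)
  split.
    transitivity ((c ^+ 2 + s ^+ 2) * (c * h00 + s * h10)); first by rewrite cs mul1r.
    transitivity (c * 0 - s * 0 : R); last by ring.
    by rewrite -{1}P0 -Q0; ring.
  transitivity ((c ^+ 2 + s ^+ 2) * (c * h10 + s * h11)); first by rewrite cs mul1r.
  transitivity (s * 0 + c * 0 : R); last by ring.
  by rewrite -{1}P0 -Q0; ring.
move=> [ab0 /vE[z0 z1]]; exists a, b; rewrite qE dqE /q /dq; split=> //.
  move: z0 z1; move: (h _) (v 0 0) (v 0 1) => g c s z0 z1.
  transitivity (c * 0 + s * 0 : R); last by ring.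
  by rewrite -{1}z0 -z1; ring.
move: z0 z1; move: (h _) (v 0 0) (v 0 1) => g c s z0 z1.
transitivity (2 * (c * 0 - s * 0) : R); last by ring.
by rewrite -{1}z1 -z0; ring.
Qed.

End Frame.

(** * Asymptotic and binormal directions of the surface *)

Lemma row2_sum_delta (R : pzRingType) (v : 'rV[R]_2) :
  v = v 0 0 *: delta_mx 0 0 + v 0 1 *: delta_mx 0 1.
Proof.
by rewrite {1}[v]row_sum_delta sum_ord2.
Qed.

Lemma row_mx0_delta (R : pzRingType) n (v : 'rV[R]_2) :
  row_mx v 0 = v 0 0 *: delta_mx 0 (lshift n 0) + v 0 1 *: delta_mx 0 (lshift n 1)
    :> 'rV[R]_(2 + n).
Proof.
rewrite !delta_mx_lshift !scale_row_mx add_row_mx !scaler0 addr0.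
by rewrite -row2_sum_delta.
Qed.

Lemma row_0mx_delta (R : pzRingType) n (v : 'rV[R]_2) :
  row_mx 0 v = v 0 0 *: delta_mx 0 (rshift n 0) + v 0 1 *: delta_mx 0 (rshift n 1)
    :> 'rV[R]_(n + 2).
Proof.
rewrite !delta_mx_rshift !scale_row_mx add_row_mx !scaler0 addr0.
by rewrite -row2_sum_delta.
Qed.

Section GraphDirections.
Context {R : realType}.
Variables (N : set 'rV[R]_4) (X0 : 'rV[R]_2 -> 'rV[R]_4) (U0 : set 'rV[R]_2).
Hypothesis X0_graph : forall z, lsubmx (X0 z : 'rV[R]_(2 + 2)) = z.
Hypothesis X0_tangent :
  forall w, 'd X0 0 w = (row_mx w 0 : 'rV[R]_(2 + 2)) :> 'rV[R]_4.
Hypothesis X0_param : local_parametrisation N 0 X0 U0 0.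

Let H nu := hessian (height X0 nu) 0.

(** Since [J] is invertible, [w] can be chosen with [w *m J = lsubmx nu], which is then orthogonal
    to itself. *)
Lemma normal_lsubmx (J : 'M[R]_2) (nu : 'rV[R]_(2 + 2)) : J \in unitmx ->
  (forall w, dot (row_mx (w *m J) 0 : 'rV[R]_(2 + 2)) nu = 0) ->
  lsubmx nu = 0.
Proof.
move=> J_unit orth; apply: dot_self_eq0.
by have := orth (lsubmx nu *m invmx J); rewrite mulmxKV // dot_row_mx0.
Qed.

(** With [v = (cos t, sin t)], the witness is [Y = v *m J], the same tangent vector in Monge
    coordinates. The relation [v *m J *m H nu *m J^T = 0] loses its last factor because [J] is
    invertible. *)
Lemma asymptotic_hessian w : asymptotic N 0 w ->
  exists Y nu, [/\ Y != 0, w = (row_mx Y 0 : 'rV[R]_(2 + 2)), nu != 0,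
    lsubmx (nu : 'rV[R]_(2 + 2)) = 0 & Y *m H nu = 0].
Proof.
move=> [X [U [u [e [t [lpX frame wE]]]]]].
have X2 := lp_twice lpX.
have [J [J_unit dXE HE]] :=
    change_of_parametrisation X0_graph X0_tangent X0_param lpX.
pose v : 'rV[R]_2 := cos t *: delta_mx 0 0 + sin t *: delta_mx 0 1.
have v0 : v 0 0 = cos t by rewrite !mxE /= mulr1 mulr0 addr0.
have v1 : v 0 1 = sin t by rewrite !mxE /= mulr1 mulr0 add0r.
rewrite (dependent_frame X2 frame v0 v1) => -[a [b [ab0 vH]]].
have [on eE] := frame.
pose nu := a *: e (rshift 2 0) + b *: e (rshift 2 1).
have nu_a : dot nu (e (rshift 2 0)) = a.
  by rewrite dotDl !dotZl !on /= mulr1 mulr0 addr0.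
have nu_b : dot nu (e (rshift 2 1)) = b.
  by rewrite dotDl !dotZl !on /= mulr1 mulr0 add0r.
have dX : differentiable X u := nbhs_singleton X2.1.
have dXe z : 'd X u z = \sum_j z 0 j *: e (lshift 2 j).
  by rewrite diff_row //; apply: eq_bigr => j _; rewrite -eE.
have nu_normal : lsubmx (nu : 'rV[R]_(2 + 2)) = 0.
  (* The image of ['d X u] is spanned by the first two frame vectors, and [nu] is a combination of
     the last two. *)
  apply: (normal_lsubmx J_unit) => z; rewrite -dXE dXe.
  rewrite sum_ord2 dotDl !dotZl.
  by rewrite !dotDr !dotZr !on /= !(mulr0, addr0).
exists (v *m J), nu; split; [| | |exact: nu_normal|].
- apply/eqP => vJ0.
  have v_0 : v = 0 by rewrite -[v](mulmxK J_unit) vJ0 mul0mx.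
  have := cos2Dsin2 t; rewrite -v0 -v1 v_0 !mxE expr0n addr0 => /eqP.
  by rewrite eq_sym oner_eq0.
- by rewrite wE -dXE dXe sum_ord2 -v0 -v1.
- apply/eqP => nu0; move: ab0; rewrite -nu_a -nu_b nu0.
  by rewrite !dotE !mul0mx mxE eqxx.
- have JT : J^T \in unitmx by rewrite unitmx_tr.
  have E : v *m J *m H nu *m J^T = 0.
    by rewrite -[RHS]vH (HE nu nu_normal) !mulmxA.
  by rewrite -[LHS](mulmxK JT) E mul0mx.
Qed.

(** The scalar is the inverse length of [Y], since [asymptotic] contains unit vectors only. The
    Monge parametrisation with the standard basis as frame is the witness. *)
Lemma hessian_asymptotic (Y : 'rV[R]_2) nu : Y != 0 -> nu != 0 ->
  lsubmx (nu : 'rV[R]_(2 + 2)) = 0 -> Y *m H nu = 0 ->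
  exists2 c, c != 0 & asymptotic N 0 (row_mx (c *: Y) 0 : 'rV[R]_(2 + 2)).
Proof.
move=> Y0 nu_neq0 nu_normal YH.
have X2 := lp_twice X0_param.
pose r := Num.sqrt (dot Y Y).
have YY : dot Y Y = Y 0 0 ^+ 2 + Y 0 1 ^+ 2.
  by rewrite dot2.
have YY_ge0 : 0 <= dot Y Y by rewrite YY addr_ge0 ?sqr_ge0.
have r0 : r != 0.
  rewrite sqrtr_eq0 -ltNge lt_def YY_ge0 andbT.
  by apply: contra_neq Y0 => /dot_self_eq0.
have r2 : r ^+ 2 = dot Y Y by rewrite sqr_sqrtr.
exists r^-1; first by rewrite invr_eq0.
set v := r^-1 *: Y.
have [t [ct st]] : exists t, cos t = v 0 0 /\ sin t = v 0 1.
  apply: circle_param; rewrite !mxE !exprMn -mulrDr -YY -r2 exprVn mulVf //.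
  by rewrite expf_eq0.
pose e (i : 'I_(2 + 2)) : 'rV[R]_(2 + 2) := delta_mx 0 i.
have frame : adapted_frame X0 0 e.
  split=> [i j|i].
    rewrite dotE /e trmx_delta mul_delta_mx_cond.
    by case: (i == j); rewrite ?mulr1n ?mulr0n mxE.
  rewrite /e delta_mx_lshift -X0_tangent -deriveE //.
  exact: nbhs_singleton X2.1.
exists X0, U0, 0, e, t; split => //.
  by rewrite ct st; exact: row_mx0_delta.
rewrite (dependent_frame X2 frame (esym ct) (esym st)).
pose n : 'rV[R]_2 := rsubmx (nu : 'rV[R]_(2 + 2)).
have nuE : nu = n 0 0 *: e (rshift 2 0) + n 0 1 *: e (rshift 2 1).
  by rewrite -[LHS](@hsubmxK R 1 2 2) nu_normal; exact: row_0mx_delta.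
exists (n 0 0), (n 0 1); split.
  rewrite -negb_and; apply: contra nu_neq0 => /andP[/eqP n0 /eqP n1].
  by rewrite nuE n0 n1 !scale0r addr0.
by rewrite -nuE -scalemxAl YH scaler0.
Qed.

(** A change of parametrisation multiplies the determinant by the nonzero factor [\det J ^+ 2];
    conversely [X0] itself is a witness. *)
Lemma binormal_hessian nu : binormal N 0 nu <->
  [/\ nu != 0, lsubmx (nu : 'rV[R]_(2 + 2)) = 0 & \det (H nu) = 0].
Proof.
split.
  move=> [nu0 [X [U [u [lpX dXnu [_ detH]]]]]].
  have [J [J_unit dXE HE]] :=
    change_of_parametrisation X0_graph X0_tangent X0_param lpX.
  have nu_normal : lsubmx (nu : 'rV[R]_(2 + 2)) = 0.
    by apply: (normal_lsubmx J_unit) => w; rewrite -dXE.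
  split; [exact: nu0|exact: nu_normal|].
  move: detH; rewrite (HE nu nu_normal) !det_mulmx det_tr => /eqP.
  move: J_unit; rewrite unitmxE unitfE => /negPf J0.
  by rewrite !mulf_eq0 J0 orbF => /eqP.
move=> [nu0 nu_normal detH]; split; first exact: nu0.
exists X0, U0, 0; split; first exact: X0_param.
  move=> w; rewrite X0_tangent [LHS](@dot_row_mx0 R 2 2) nu_normal.
  by rewrite dotE trmx0 mulmx0 mxE.
split; last exact: detH.
move=> i; have [dh _] := height_twice nu (lp_twice X0_param).
rewrite /partial (deriveE _ (nbhs_singleton dh)).
exact: (height_critical X0_tangent X0_param nu_normal).
Qed.

End GraphDirections.

(** * The projected surface *)

(* [b *m embed3 R] is the vector (b_0, 0, b_1, b_2). *)
Definition embed3 (R : realType) : 'M[R]_(3, 4) := row' 1 1%:M.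

Lemma perp_coordsE (R : realType) (z : 'rV[R]_4) :
  perp_coords z = z *m (embed3 R)^T.
Proof.
apply/rowP => i; rewrite !mxE (bigD1 (lift 1 i)) //= !mxE eqxx mulr1.
rewrite big1 ?addr0 // => j /negPf ji.
by rewrite !mxE eq_sym ji mulr0.
Qed.

(** The projection changes only the coordinate that [perp_coords] drops. *)
Lemma perp_coords_proj (R : realType) (z : 'rV[R]_4) :
  perp_coords (proj_along (dir_v R) z) = perp_coords z.
Proof.
apply/rowP => i; rewrite !mxE [_ == 1]eq_sym (negPf (neq_lift _ _)) andbF.
by rewrite mulr0 subr0.
Qed.

(** Adjointness: a height function of the projected surface is the height function of [N] along the
    embedded vector. *)
Lemma dot_perp_coords (R : realType) (z : 'rV[R]_4) (b : 'rV[R]_3) :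
  dot (perp_coords z) b = dot z (b *m embed3 R).
Proof. by rewrite !dotE perp_coordsE trmx_mul mulmxA. Qed.

Lemma embed3K (R : realType) (b : 'rV[R]_3) :
  perp_coords (b *m embed3 R) = b.
Proof.
apply/rowP => i; rewrite !mxE (bigD1 i) //= !mxE eqxx mulr1.
rewrite big1 ?addr0 // => j /negPf ji.
by rewrite !mxE (inj_eq lift_inj) ji mulr0.
Qed.

Lemma embed3_1 (R : realType) (b : 'rV[R]_3) : (b *m embed3 R) 0 1 = 0.
Proof.
rewrite mxE big1 // => j _.
by rewrite !mxE eq_sym (negPf (neq_lift _ _)) mulr0.
Qed.

Lemma perp_coordsK (R : realType) (z : 'rV[R]_4) : z 0 1 = 0 ->
  perp_coords z *m embed3 R = z.
Proof.
move=> z1; apply/rowP => j; case: (unliftP 1 j) => [i ->|->]; last first.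
  by rewrite embed3_1 z1.
rewrite mxE (bigD1 i) //= !mxE eqxx mulr1 big1 ?addr0 // => k /negPf ki.
by rewrite !mxE (inj_eq lift_inj) ki mulr0.
Qed.

Lemma lsubmx_eq0 (R : realType) (z : 'rV[R]_(2 + 2)) :
  lsubmx z = 0 <-> z 0 (lshift 2 0) = 0 /\ z 0 (lshift 2 1) = 0.
Proof.
split=> [z0|[z0 z1]]; last first.
  by apply/rowP; apply: ord2P; rewrite !mxE.
by have := congr1 (fun y : 'rV[R]_2 => (y 0 0, y 0 1)) z0; rewrite !mxE => -[].
Qed.

Lemma embed3_normal (R : realType) (b : 'rV[R]_3) :
  lsubmx (b *m embed3 R : 'rV[R]_(2 + 2)) = 0 <-> b 0 0 = 0.
Proof.
rewrite lsubmx_eq0.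
have l1 : @lshift 2 2 1 = 1 :> 'I_4 by apply: val_inj.
have l0 : @lshift 2 2 0 = lift 1 0 :> 'I_4 by apply: val_inj.
have E0 : (b *m embed3 R) 0 (lift 1 0) = b 0 0.
  by rewrite -[in RHS](embed3K b) [RHS]mxE.
split=> [[]|b0]; first by rewrite [@lshift 2 2 0]l0 E0.
by rewrite [@lshift 2 2 1]l1 embed3_1 [@lshift 2 2 0]l0 E0.
Qed.

(** Computed entry by entry: the first two entries are coordinate functions, and the last two have
    zero differential. *)
Lemma monge_tangent (R : realType) (f1 f2 : 'rV[R]_2 -> R) (w : 'rV[R]_2) :
  differentiable (monge f1 f2) 0 ->
  differentiable f1 0 -> differentiable f2 0 ->
  (forall w, 'd f1 0 w = 0) -> (forall w, 'd f2 0 w = 0) ->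
  'd (monge f1 f2) 0 w = (row_mx w 0 : 'rV[R]_(2 + 2)) :> 'rV[R]_4.
Proof.
move=> dX d1 d2 df1 df2.
have entry j : 'd (monge f1 f2) 0 w 0 j = 'D_w (fun z => monge f1 f2 z 0 j) 0.
  rewrite -(deriveE _ dX) derive_mx ?mxE //; exact: diff_derivable.
have coordE j : 'D_w (fun z : 'rV[R]_2 => z 0 j) 0 = w 0 j.
  by rewrite -{2}(derive_id 0 w) derive_mx ?mxE //; exact: derivable_id.
apply/rowP => j; rewrite entry -[j](@fintype.splitK 2 2).
case: (@fintype.split 2 2 j); apply: ord2P => /=.
- rewrite [RHS](@row_mxEl _ 1 2 2) -coordE; congr ('D_w _ 0).
  by apply/funext => z; rewrite mxE.
- rewrite [RHS](@row_mxEl _ 1 2 2) -coordE; congr ('D_w _ 0).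
  by apply/funext => z; rewrite mxE.
- rewrite [RHS](@row_mxEr _ 1 2 2) mxE -(df1 w) -(deriveE _ d1).
  by congr ('D_w _ 0); apply/funext => z; rewrite mxE.
- rewrite [RHS](@row_mxEr _ 1 2 2) mxE -(df2 w) -(deriveE _ d2).
  by congr ('D_w _ 0); apply/funext => z; rewrite mxE.
Qed.

(** * Second fundamental form of the projection *)

Section Projection.
Context {R : realType}.
Variables (X0 : 'rV[R]_2 -> 'rV[R]_4) (f : 'rV[R]_2 -> 'rV[R]_3).
Hypothesis X0_tangent :
  forall w, 'd X0 0 w = (row_mx w 0 : 'rV[R]_(2 + 2)) :> 'rV[R]_4.
Hypothesis X0_twice : twice_differentiable X0 0.
Hypothesis fE : f = @perp_coords R \o X0.

Let H nu := hessian (height X0 nu) 0.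

Let L : {linear 'rV[R]_4 -> 'rV[R]_3} := mulmxr (embed3 R)^T.

Let fL : f = L \o X0.
Proof. by rewrite fE; apply/funext => z /=; rewrite perp_coordsE. Qed.

Let f_twice : twice_differentiable f 0.
Proof.
rewrite fL; apply: twice_differentiable_linear_comp => //.
exact: linear_row_continuous.
Qed.

(** By adjointness, pairing ['d f 0 w] with [nu] pairs [w] with the tangential part of the embedded
    [nu]. *)
Lemma normal_spaceE nu : Defs.normal_space f 0 nu <->
  lsubmx (nu *m embed3 R : 'rV[R]_(2 + 2)) = 0.
Proof.
have dX0 : differentiable X0 0 := nbhs_singleton X0_twice.1.
have df w : 'd f 0 w = perp_coords (row_mx w 0 : 'rV[R]_(2 + 2)).
  rewrite -(deriveE _ (nbhs_singleton f_twice.1)) fL.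
  rewrite (derive_linear_comp (@linear_row_continuous _ _ _ L)) //.
  by rewrite (deriveE _ dX0) X0_tangent perp_coordsE.
have dotdf w : dot ('d f 0 w) nu =
    dot w (lsubmx (nu *m embed3 R : 'rV[R]_(2 + 2))).
  by rewrite df dot_perp_coords [LHS](@dot_row_mx0 R 2 2).
split=> [n|n _ [w _ <-]]; last by rewrite dotdf n dotE trmx0 mulmx0 mxE.
apply: dot_self_eq0; rewrite -dotdf; apply: n.
by exists (lsubmx (nu *m embed3 R : 'rV[R]_(2 + 2))).
Qed.

Lemma dot_orth_proj z nu : Defs.normal_space f 0 nu ->
  dot (orth_proj (Defs.normal_space f 0) z) nu = dot z nu.
Proof.
move=> nu_normal; rewrite /orth_proj.
have : exists a, Defs.normal_space f 0 a /\
    forall b, Defs.normal_space f 0 b -> dot (z - a) b = 0.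
  (* [xget] falls back on its default unless a projection exists. The normal space is the plane
     where the first coordinate vanishes, so clearing that coordinate gives one. *)
  pose a := z - z 0 0 *: delta_mx 0 0.
  exists a; split=> [|b].
    by rewrite normal_spaceE embed3_normal !mxE eqxx mulr1 subrr.
  rewrite normal_spaceE embed3_normal /a opprB addrC subrK dotZl => b0.
  rewrite dotC /dot (bigD1 0) //= b0 mul0r add0r big1 ?mulr0 // => i /negPf i0.
  by rewrite mxE i0 andbF mulr0.
move=> /(xgetPex 0); set a := xget _ _ => -[_ /(_ nu nu_normal)].
have -> : z - a = z + (-1) *: a by rewrite scaleN1r.
by rewrite dotDl dotZl mulN1r => /eqP; rewrite subr_eq0 => /eqP.
Qed.

(** Orthogonal projection is invisible when paired with a normal [nu], so the coefficients are
    entries of the Hessian of a height function of [N]; its symmetry accounts for the mixed term. *)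
Lemma dot_second_ff3 Y Z nu : Defs.normal_space f 0 nu ->
  dot (second_ff3 f 0 Y Z) nu = dot (Y *m H (nu *m embed3 R)) Z.
Proof.
move=> nu_normal.
have hE i j : dot (partial i (partial j f) 0) nu = H (nu *m embed3 R) i j.
  rewrite -(hessian_dot nu i j f_twice) /H.
  have -> // : (fun z => dot (f z) nu) = height X0 (nu *m embed3 R).
  by apply/funext => z; rewrite fE /= dot_perp_coords.
have Hs := hessian_sym 0 1 (height_twice (nu *m embed3 R) X0_twice).
have h00 := hE 0 0; have h10 := hE 1 0; have h11 := hE 1 1.
rewrite /second_ff3; move: h00 h10 h11 Hs; rewrite -/(H _).
move: (H _) (partial 0 (partial 0 f) 0) (partial 1 (partial 0 f) 0)
  (partial 1 (partial 1 f) 0) => K a b c aK bK cK Ks.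
rewrite 2!dotDl 3!dotZl (dot_orth_proj a) // (dot_orth_proj b) //.
rewrite (dot_orth_proj c) // aK bK cK.
by rewrite dot2 !row2_mulmx Ks; ring.
Qed.

(** For the forward direction, [Z] is taken to be [Y *m H (nu *m embed3 R)], which becomes
    orthogonal to itself. *)
Lemma asymptotic_binormal3E Y nu : asymptotic_binormal3 f 0 Y nu <->
  [/\ Y != 0, nu != 0, lsubmx (nu *m embed3 R : 'rV[R]_(2 + 2)) = 0 &
      Y *m H (nu *m embed3 R) = 0].
Proof.
split=> [[Y0 nu0 n YZ]|[Y0 nu0 n YH]].
  split=> //; first exact/normal_spaceE.
  by apply: dot_self_eq0; rewrite -dot_second_ff3.
split=> //; first exact/normal_spaceE.
move=> Z; rewrite dot_second_ff3; last exact/normal_spaceE.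
by rewrite YH dotE mul0mx mxE.
Qed.

End Projection.

Theorem proposition3p1 (R : realType) (N : set 'rV[R]_4)
    (f1 f2 : 'rV[R]_2 -> R) (U : set 'rV[R]_2)
    (N_regular : regular_surface N)
    (N0 : N 0)
    (f1_smooth : smooth_on U f1)
    (f2_smooth : smooth_on U f2)
    (f1_0 : f1 0 = 0)
    (f2_0 : f2 0 = 0)
    (df1_0 : forall w, 'd f1 0 w = 0)
    (df2_0 : forall w, 'd f2 0 w = 0)
    (N_monge : local_parametrisation N 0 (monge f1 f2) U 0) :
  let f : 'rV[R]_2 -> 'rV[R]_3 := monge_projection f1 f2 in
  directions (asymptotic N 0) #= directions (asymptotic3 f 0) /\
  (directions (binormal N 0) #= directions (binormal3 f 0) /\
   forall nu : 'rV[R]_4, binormal N 0 nu -> binormal3 f 0 (perp_coords nu)).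
Proof.
move=> f; set X0 := monge f1 f2 in N_monge *.
have U0 : U 0 by have [] := N_monge.
have X2 : twice_differentiable X0 0 := lp_twice N_monge.
have graph z : lsubmx (X0 z : 'rV[R]_(2 + 2)) = z.
  by apply/rowP; apply: ord2P; rewrite !mxE.
have tangent w : 'd X0 0 w = (row_mx w 0 : 'rV[R]_(2 + 2)) :> 'rV[R]_4.
  apply: monge_tangent => //; first exact: nbhs_singleton X2.1.
    exact: (f1_smooth [::]).
  exact: (f2_smooth [::]).
have fE : f = @perp_coords R \o X0.
  by apply/funext => z; rewrite /f /monge_projection perp_coords_proj.
have ab3E := asymptotic_binormal3E tangent X2 fE.
have embedK nu : lsubmx (nu : 'rV[R]_(2 + 2)) = 0 ->
    perp_coords nu *m embed3 R = nu.
  move=> /lsubmx_eq0[_ n1]; apply: perp_coordsK; rewrite -n1.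
  by congr (nu 0 _); apply: val_inj.
have perp_neq0 nu : nu != 0 -> lsubmx (nu : 'rV[R]_(2 + 2)) = 0 ->
    perp_coords nu != 0.
  by move=> nu0 /embedK E; apply: contra_neq nu0 => p0; rewrite -E p0 mul0mx.
(* A singular Hessian has a nonzero left kernel vector [Y], which is the asymptotic direction paired
   with [nu]. *)
have bin3 nu : binormal N 0 nu -> binormal3 f 0 (perp_coords nu).
  move=> /(binormal_hessian graph tangent N_monge)[nu0 n /eqP/det0P[Y Y0 YH]].
  exists Y; apply/ab3E; rewrite embedK //; split => //; exact: perp_neq0.
split; last split => //.
(* Asymptotic directions correspond under [Y |-> (Y, 0)], the differential of the Monge
   parametrisation at the origin. *)
- apply: (@directions_card_eq _ _ _ (mulmxr (row_mx 1%:M 0 : 'M[R]_(2, 2 + 2)))).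
  + move=> x y /=; rewrite !mul_mx_row !mulmx1 !mulmx0.
    by move=> /eq_row_mx[].
  + move=> w /(asymptotic_hessian graph tangent N_monge)[Y [nu [Y0 wE nu0 n YH]]].
    exists Y; last by rewrite /= mul_mx_row mulmx1 mulmx0.
    exists (perp_coords nu); apply/ab3E; rewrite embedK //; split => //.
    exact: perp_neq0.
  + move=> Y [nu /ab3E[Y0 nu0 n YH]].
    have nu0' : nu *m embed3 R != 0.
      by apply: contra_neq nu0 => E; rewrite -(embed3K nu) E perp_coordsE mul0mx.
    have [c c0 cY] := hessian_asymptotic tangent N_monge Y0 nu0' n YH.
    by exists c => //=; rewrite mul_mx_row mulmx1 mulmx0.
(* Binormal directions correspond under the identification of the normal planes; binormal vectors
   are not normalised, so the scalar is [1]. *)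
- apply: (@directions_card_eq _ _ _ (mulmxr (embed3 R))).
  + by move=> x y /= /(congr1 (@perp_coords R)); rewrite !embed3K.
  + move=> nu bnu; exists (perp_coords nu); first exact: bin3.
    have [_ n _] := (binormal_hessian graph tangent N_monge nu).1 bnu.
    by rewrite /= embedK.
  + move=> nu [Y /ab3E[Y0 nu0 n YH]]; exists 1; first exact: oner_neq0.
    rewrite scale1r /=; apply/(binormal_hessian graph tangent N_monge).
    split=> //; last by apply/eqP/det0P; exists Y.
    by apply: contra_neq nu0 => E; rewrite -(embed3K nu) E perp_coordsE mul0mx.
Qed.
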